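(* Let $n\geq 1$, let $Q_{n-1}$ be a polynomial of degree at most $n-1$ satisfying conditions (i) and (ii) of the context, with nodes $x_{n,k}$, and let $R_n$ be the associated rational Bernstein operator. Put $\Delta_n=\sup_{0\leq k\leq n-1}|x_{n,k+1}-x_{n,k}|$. Then for all $f\in C[0,1]$ and all $x\in[0,1]$, $$\left|R_nf(x)-f(x)\right|\leq\left(1+\sqrt{x(1-x)}\right)\omega_1\left(f,\sqrt{\Delta_n}\right).$$
   Context: $C[0,1]$ is the space of continuous real-valued functions on $[0,1]$. The first modulus of continuity of $f\in C[0,1]$ is $\omega_1(f,h)=\sup\{|f(x)-f(y)|: x,y\in[0,1],\ |x-y|\leq h\}$, $h>0$. Let $n\geq 1$ and let $Q_{n-1}$ be a polynomial of degree at most $n-1$, strictly positive on $[0,1]$. Write $Q_{n-1}(x)=\sum_{k=0}^{n-1}\gamma_{n-1,k}\,x^k(1-x)^{n-1-k}$ and $\gamma_{n-1,k}=w_{n-1,k}\binom{n-1}{k}$, so that the $w_{n-1,k}$ are the Bernstein coefficients of $Q_{n-1}$. Conditions: (i) $w_{n-1,k}>0$ for $k=0,\dots,n-1$; (ii) property (W): $\frac{w_{n-1,k-1}w_{n-1,k+1}}{w_{n-1,k}^2}<\frac{k+1}{k}\cdot\frac{n-k}{n-k-1}$ for $k=1,\dots,n-2$ (equivalently, $\gamma_{n-1,k-1}/\gamma_{n-1,k}$ is strictly increasing in $k=1,\dots,n-1$). Convention: $\gamma_{n-1,-1}=\gamma_{n-1,n}=0$. The nodes are $x_{n,k}=\frac{\gamma_{n-1,k-1}}{\gamma_{n-1,k}+\gamma_{n-1,k-1}}$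 for $k=0,\dots,n$; under (i) and (ii) one has $0=x_{n,0}<x_{n,1}<\dots<x_{n,n}=1$. The rational Bernstein operator associated with $Q_{n-1}$ is $$R_nf(x)=\sum_{k=0}^{n}f(x_{n,k})\,(\gamma_{n-1,k}+\gamma_{n-1,k-1})\,\frac{x^k(1-x)^{n-k}}{Q_{n-1}(x)},\qquad f\in C[0,1],$$ which reproduces the functions $1$ and $x$. *)

(* Defs.v *)
From mathcomp Require Import all_boot all_order all_algebra.
From mathcomp Require Import all_classical all_reals all_analysis.
Import Order.TTheory GRing.Theory Num.Theory.
Import numFieldNormedType.Exports.
Set Implicit Arguments.
Unset Strict Implicit.
Unset Printing Implicit Defensive.
Local Open Scope classical_set_scope.
Local Open Scope ring_scope.

Definition modulus1 (R : realType) (f : R -> R) (h : R) : R :=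
  sup [set d : R | exists x y : R,
    [/\ x \in `[0, 1], y \in `[0, 1], `|x - y| <= h & d = `|f x - f y|]].

(* gam n w k is gamma_{n-1,k}; it vanishes for k >= n >= 1 because the
   binomial coefficient does, so gamma_{n-1,n} = 0 holds by construction. *)
Definition gam (R : realType) (n : nat) (w : nat -> R) (k : nat) : R :=
  w k * 'C(n.-1, k)%:R.

(* gam_pred n w k is gamma_{n-1,k-1}, with gamma_{n-1,-1} = 0. *)
Definition gam_pred (R : realType) (n : nat) (w : nat -> R) (k : nat) : R :=
  if k is j.+1 then gam n w j else 0.

(* As the Bernstein basis is free, this determines w k for k < n; the values
   w k for k >= n are irrelevant. *)
Definition is_bernstein_coefs (R : realType) (n : nat) (Q : {poly R})
    (w : nat -> R) : Prop :=
  Q = \sum_(k < n) gam n w k *: ('X^k * (1 - 'X) ^+ (n.-1 - k)).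

Definition propertyW (R : realType) (n : nat) (w : nat -> R) : Prop :=
  forall k : nat, (1 <= k <= n - 2)%N ->
    w k.-1 * w k.+1 / w k ^+ 2 <
      (k%:R + 1) / k%:R * ((n%:R - k%:R) / (n%:R - k%:R - 1)).

Definition node (R : realType) (n : nat) (w : nat -> R) (k : nat) : R :=
  gam_pred n w k / (gam n w k + gam_pred n w k).

Definition mesh (R : realType) (n : nat) (w : nat -> R) : R :=
  sup [set `|node n w k.+1 - node n w k| | k in [set k : nat | (k < n)%N]].

Definition rat_bernstein (R : realType) (n : nat) (Q : {poly R})
    (w : nat -> R) (f : R -> R) (x : R) : R :=
  \sum_(k < n.+1) f (node n w k) * (gam n w k + gam_pred n w k)
    * (x ^+ k * (1 - x) ^+ (n - k) / Q.[x]).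

(* Main.v *)
Require Import Defs.
From mathcomp Require Import all_boot all_order all_algebra.
From mathcomp Require Import all_classical all_reals all_analysis.
From mathcomp Require Import ring lra.
Import Order.TTheory GRing.Theory Num.Theory.
Import numFieldNormedType.Exports.
Set Implicit Arguments.
Unset Strict Implicit.
Unset Printing Implicit Defensive.
Local Open Scope classical_set_scope.
Local Open Scope ring_scope.


(** The operator [R_n] is an average: at a fixed [x] it is the expectation of
    [f] at a random node of mean [x].  The usual Jackson-type argument therefore
    reduces the estimate to a bound on the variance of that random node.  As
    [|f t - f x| <= (1 + |t - x| / h) * modulus1 f h] ([modulus1_scale]) and the
    mean of [|t - x|] is at most the standard deviation
    ([average_norm_le_sqrt]), the error is at most
    [(1 + sqrt variance / h) * modulus1 f h]; with [h = sqrt mesh], the bound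
    [variance <= x * (1 - x) * mesh] gives the theorem.

    The variance is computed exactly.  Let [q_k] be the terms of
    [Q(x) = \sum_k gam_k x^k (1-x)^(n-1-k)] divided by [Q(x)]: these are
    probability weights on [0, ..., n-1].  By the choice of the nodes, the
    weight [p_k] of the operator at the node [x_k] splits as
    [p_k = (1-x) q_k + x q_(k-1)], with [p_k x_k = x q_(k-1)].  So the random
    node can be drawn by picking [k] with probability [q_k] and then moving from
    [x_k] to [x_(k+1)] with probability [x].  Writing [A] and [B] for the
    [q]-averages of [x_k] and [x_(k+1)], one gets
    [x = \sum_k p_k x_k = (1-x) A + x B] and [\sum_k p_k x_k^2 = x B], hence
    [variance = x B - x^2 = x (1-x) (B - A)], and [B - A] is an average of the
    gaps [x_(k+1) - x_k], each at most the mesh ([op_variance],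
    [op_variance_le_mesh]). *)

(** * The modulus of continuity *)

Section Modulus.
Variables (R : realType) (f : R -> R).
Hypothesis hf : {within `[0, 1], continuous f}.

(** The supremum of a set of reals is an upper bound only when the set is
    bounded; here this comes from the extrema of [f] on the compact [0, 1]. *)
Lemma modulus1_ub (h x y : R) : x \in `[0, 1] -> y \in `[0, 1] ->
  `|x - y| <= h -> `|f x - f y| <= modulus1 f h.
Proof.
move=> x01 y01 xyh; apply: ub_le_sup; last by exists x, y.
have [a a01 fmax] := EVT_max (ler01 : (0 : R) <= 1) hf.
have [b b01 fmin] := EVT_min (ler01 : (0 : R) <= 1) hf.
exists (f a - f b) => _ [u [v [u01 v01 _ ->]]].
have := (fmax _ u01, fmin _ u01, fmax _ v01, fmin _ v01).
move=> [[[ua ub] va] vb].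
by rewrite ler_norml; apply/andP; split; lra.
Qed.

Lemma modulus1_ge0 (h : R) : 0 <= h -> 0 <= modulus1 f h.
Proof.
move=> h0; apply: (le_trans (normr_ge0 (f 0 - f 0))).
by apply: modulus1_ub; rewrite ?subrr ?normr0 // in_itv /= lexx ler01.
Qed.

(** The segment from [x] to [y] is cut into [N] equal pieces of length at most
    [h], and the increments of [f] over the pieces add up. *)
Lemma modulus1_chain (h : R) (N : nat) (x y : R) :
  x \in `[0, 1] -> y \in `[0, 1] ->
  `|x - y| <= N%:R * h -> `|f x - f y| <= N%:R * modulus1 f h.
Proof.
elim: N x => [|N IH] x x01 y01.
  by rewrite !mul0r !normr_le0 !subr_eq0 => /eqP ->.
move=> xyh; have N1 : 0 < N.+1%:R :> R by rewrite ltr0n.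
(* [z] is the first subdivision point: it is one [N.+1]-th of the way to [y]. *)
pose t : R := N.+1%:R^-1.
have t0 : 0 <= t by rewrite invr_ge0 ltW.
have t1 : t <= 1 by rewrite invf_le1 // ler1n.
have tN : N.+1%:R * t = 1 by rewrite divff ?gt_eqF.
pose z := x + t * (y - x).
have z01 : z \in `[0, 1].
  move: x01 y01; rewrite !in_itv /= /z => /andP[? ?] /andP[? ?].
  by apply/andP; split; nra.
have xz : `|x - z| <= h.
  rewrite (_ : x - z = t * (x - y)); last by rewrite /z; ring.
  by rewrite normrM (ger0_norm t0) mulrC ler_pdivrMr // mulrC.
have zy : `|z - y| <= N%:R * h.
  have -> : z - y = (N%:R * t) * (x - y).
    have -> : N%:R * t = 1 - t by rewrite -[X in _ = X - _]tN -natr1 mulrDl mul1r addrK.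
    by rewrite /z; ring.
  rewrite normrM ger0_norm ?mulr_ge0 // -mulrA ler_wpM2l //.
  by rewrite mulrC ler_pdivrMr // mulrC.
rewrite (_ : f x - f y = (f x - f z) + (f z - f y)); last by ring.
apply: (le_trans (ler_normD _ _)).
rewrite -natr1 mulrDl mul1r addrC lerD //; first exact: IH.
exact: modulus1_ub.
Qed.

Lemma modulus1_scale (h x y : R) : 0 < h -> x \in `[0, 1] -> y \in `[0, 1] ->
  `|f x - f y| <= (1 + `|x - y| / h) * modulus1 f h.
Proof.
move=> h0 x01 y01; have r0 : 0 <= `|x - y| / h by rewrite divr_ge0 // ltW.
have /andP[lo hi] := truncn_itv r0.
apply: (le_trans (modulus1_chain (N := (Num.truncn (`|x - y| / h)).+1) (h := h)
  x01 y01 _)).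
  by rewrite -ler_pdivrMr // ltW.
by rewrite ler_wpM2r ?modulus1_ge0 ?(ltW h0) // -natr1 [leRHS]addrC lerD2r.
Qed.

End Modulus.

(** * Averages with finitely many weights *)

Section Averages.
Variables (R : realType) (I : finType) (p : I -> R).
Hypotheses (p_ge0 : forall i, 0 <= p i) (p_sum1 : \sum_i p i = 1).

(** The variance of [|d|], namely the mean of [d ^ 2] minus the square of the
    mean of [|d|], is nonnegative. *)
Lemma average_norm_le_sqrt (d : I -> R) :
  \sum_i p i * `|d i| <= Num.sqrt (\sum_i p i * d i ^+ 2).
Proof.
set m := \sum_i p i * `|d i|; set v := \sum_i p i * d i ^+ 2.
have m0 : 0 <= m by apply: sumr_ge0 => i _; rewrite mulr_ge0.
rewrite -(ger0_norm m0) -sqrtr_sqr; apply: ler_wsqrtr.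
rewrite -subr_ge0.
have -> : v - m ^+ 2 = \sum_i p i * (`|d i| - m) ^+ 2.
  have -> : \sum_i p i * (`|d i| - m) ^+ 2 =
      \sum_i (p i * d i ^+ 2 - 2 * m * (p i * `|d i|) + m ^+ 2 * p i).
    by apply: eq_bigr => i _; rewrite -(real_normK (num_real (d i))); ring.
  by rewrite big_split sumrB /= -!mulr_sumr p_sum1 -/m -/v; ring.
by apply: sumr_ge0 => i _; rewrite mulr_ge0 ?sqr_ge0.
Qed.

Lemma average_modulus1_bound (f : R -> R) (t : I -> R) (x h : R) :
  {within `[0, 1], continuous f} -> 0 < h ->
  (forall i, t i \in `[0, 1]) -> x \in `[0, 1] ->
  `|\sum_i p i * f (t i) - f x| <=
    (1 + Num.sqrt (\sum_i p i * (t i - x) ^+ 2) / h) * modulus1 f h.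
Proof.
move=> hf h0 t01 x01.
have -> : \sum_i p i * f (t i) - f x = \sum_i p i * (f (t i) - f x).
  rewrite -[X in _ - X]mul1r -p_sum1 mulr_suml -sumrB.
  by apply: eq_bigr => i _; rewrite mulrBr.
apply: (le_trans (ler_norm_sum _ _ _)).
apply: (@le_trans _ _
  (\sum_i p i * ((1 + `|t i - x| / h) * modulus1 f h))).
  apply: ler_sum => i _; rewrite normrM ger0_norm // ler_wpM2l //.
  exact: modulus1_scale.
have -> : \sum_i p i * ((1 + `|t i - x| / h) * modulus1 f h) =
    (1 + (\sum_i p i * `|t i - x|) / h) * modulus1 f h.
  rewrite -[X in _ = (X + _) * _]p_sum1 mulr_suml -big_split /= mulr_suml.
  by apply: eq_bigr => i _; ring.
rewrite ler_wpM2r ?modulus1_ge0 ?(ltW h0) // lerD2l.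
by rewrite ler_wpM2r ?invr_ge0 ?(ltW h0) // average_norm_le_sqrt.
Qed.

End Averages.

(** * Nodes and mesh *)

Section RationalBernstein.
Variables (R : realType) (n : nat) (w : nat -> R).
Hypothesis n_gt0 : (0 < n)%N.
Hypothesis w_gt0 : forall k, (k < n)%N -> 0 < w k.

Lemma gam_gt0 k : (k < n)%N -> 0 < gam n w k.
Proof.
move=> kn; rewrite /gam mulr_gt0 ?w_gt0 // ltr0n bin_gt0.
by rewrite -ltnS prednK.
Qed.

Lemma gam_out : gam n w n = 0.
Proof. by rewrite /gam bin_small ?mulr0 // prednK. Qed.

Lemma gam_ge0 k : (k <= n)%N -> 0 <= gam n w k.
Proof.
rewrite leq_eqVlt => /predU1P[->|/gam_gt0/ltW //].
by rewrite gam_out.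
Qed.

Lemma gam_pred_ge0 k : (k <= n)%N -> 0 <= gam_pred n w k.
Proof. by case: k => [|k] //= kn; rewrite ltW ?gam_gt0. Qed.

Lemma gam_add_gt0 k : (k <= n)%N -> 0 < gam n w k + gam_pred n w k.
Proof.
case: k => [|k] kn; first by rewrite addr0 gam_gt0.
by rewrite ltr_wpDl ?gam_ge0 //= gam_gt0.
Qed.

Lemma node_itv k : (k <= n)%N -> node n w k \in `[0, 1].
Proof.
move=> kn; rewrite in_itv /= /node divr_ge0 ?gam_pred_ge0 ?(ltW (gam_add_gt0 kn)) //=.
by rewrite ler_pdivrMr ?gam_add_gt0 // mul1r lerDr gam_ge0.
Qed.

Lemma node_first : node n w 0 = 0.
Proof. by rewrite /node mul0r. Qed.

Lemma node_last : node n w n = 1.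
Proof.
rewrite /node gam_out add0r divff //.
by have := gam_add_gt0 (leqnn n); rewrite gam_out add0r => /gt_eqF ->.
Qed.

Lemma node_step_le_mesh k :
  (k < n)%N -> node n w k.+1 - node n w k <= mesh n w.
Proof.
move=> kn; apply: (le_trans (ler_norm _)); apply: ub_le_sup; last by exists k.
exists 1 => _ [j /= jn <-].
have := (node_itv jn, node_itv (ltnW jn)).
rewrite !in_itv /= => -[/andP[? ?] /andP[? ?]].
by rewrite ler_norml; apply/andP; split; lra.
Qed.

(** The [n] gaps between consecutive nodes sum to [1], so they cannot all be
    at most [0]. *)
Lemma mesh_gt0 : 0 < mesh n w.
Proof.
have : 0 < n%:R * mesh n w.
  apply: (lt_le_trans ltr01).
  have steps : \sum_(k < n) (node n w k.+1 - node n w k) = 1.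
    rewrite -(big_mkord xpredT (fun k => node n w k.+1 - node n w k)).
    by rewrite telescope_sumr // node_last node_first subr0.
  rewrite -[leLHS]steps mulr_natl -[X in _ *+ X]card_ord -sumr_const.
  by apply: ler_sum => k _; exact: node_step_le_mesh.
by rewrite pmulr_rgt0 // ltr0n.
Qed.

(** * Moments of the rational Bernstein operator *)

Variables (Q : {poly R}) (x : R).
Hypothesis Q_coefs : is_bernstein_coefs n Q w.
Hypotheses (Qx_gt0 : 0 < Q.[x]) (x01 : x \in `[0, 1]).

(** The term of index [k] in the Bernstein expansion of [Q] at [x], normalised
    by [Q.[x]]: the weight [q_k] of the introduction. *)
Definition denom_weight (k : nat) : R :=
  gam n w k * (x ^+ k * (1 - x) ^+ (n.-1 - k)) / Q.[x].

Definition op_weight (k : nat) : R :=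
  (gam n w k + gam_pred n w k) * (x ^+ k * (1 - x) ^+ (n - k) / Q.[x]).

Lemma denom_weight_ge0 k : (k < n)%N -> 0 <= denom_weight k.
Proof.
move: x01; rewrite in_itv /= => /andP[x0 x1] kn.
rewrite /denom_weight divr_ge0 ?(ltW Qx_gt0) //.
by rewrite mulr_ge0 ?(ltW (gam_gt0 kn)) // mulr_ge0 ?exprn_ge0 ?subr_ge0.
Qed.

Lemma sum_denom_weight : \sum_(k < n) denom_weight k = 1.
Proof.
rewrite -mulr_suml.
have -> : \sum_(k < n) gam n w k * (x ^+ k * (1 - x) ^+ (n.-1 - k)) = Q.[x].
  rewrite Q_coefs horner_sum; apply: eq_bigr => k _.
  by rewrite !hornerE.
by rewrite divff // gt_eqF.
Qed.

Lemma op_weight_ge0 k : (k <= n)%N -> 0 <= op_weight k.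
Proof.
move: x01; rewrite in_itv /= => /andP[x0 x1] kn.
rewrite /op_weight mulr_ge0 ?(ltW (gam_add_gt0 kn)) //.
by rewrite divr_ge0 ?(ltW Qx_gt0) // mulr_ge0 ?exprn_ge0 ?subr_ge0.
Qed.

(** The node [x_k] is the share of [gam_pred] in the coefficient of the
    operator: this cancellation is what makes the moments computable. *)
Lemma op_weight_node k : (k <= n)%N -> op_weight k * node n w k =
  gam_pred n w k * (x ^+ k * (1 - x) ^+ (n - k) / Q.[x]).
Proof.
move=> kn; rewrite /op_weight /node mulrAC [X in X * _]mulrCA divff ?mulr1 //.
by rewrite gt_eqF ?gam_add_gt0.
Qed.

(** Raising the degree from [n-1] to [n] turns the term [j] of [Q] into
    [x * q_j] at index [j.+1] here, and into [(1 - x) * q_j] at index [j] in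
    [sum_gam]. *)
Lemma sum_gam_pred (g : nat -> R) :
  \sum_(k < n.+1) gam_pred n w k * (x ^+ k * (1 - x) ^+ (n - k) / Q.[x]) * g k =
  x * \sum_(k < n) denom_weight k * g k.+1.
Proof.
rewrite big_ord_recl /= !mul0r add0r mulr_sumr; apply: eq_bigr => k _.
rewrite /denom_weight /= /bump /= add1n exprS.
have -> : (n - k.+1 = n.-1 - k)%N by rewrite -subn1 -subnDA add1n.
ring.
Qed.

Lemma sum_gam (g : nat -> R) :
  \sum_(k < n.+1) gam n w k * (x ^+ k * (1 - x) ^+ (n - k) / Q.[x]) * g k =
  (1 - x) * \sum_(k < n) denom_weight k * g k.
Proof.
rewrite big_ord_recr /= gam_out !mul0r addr0 mulr_sumr; apply: eq_bigr => k _.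
rewrite /denom_weight.
have -> : (n - k = (n.-1 - k).+1)%N.
  by rewrite -subSn ?prednK // -ltnS prednK.
rewrite exprS; ring.
Qed.

(** Drawing [k] with law [q], then keeping [k] with probability [1 - x] or
    moving to [k.+1] with probability [x], gives the law [op_weight]. *)
Lemma sum_op_weight (g : nat -> R) :
  \sum_(k < n.+1) op_weight k * g k =
  (1 - x) * (\sum_(k < n) denom_weight k * g k) +
  x * \sum_(k < n) denom_weight k * g k.+1.
Proof.
rewrite -sum_gam -sum_gam_pred -big_split /=; apply: eq_bigr => k _.
by rewrite /op_weight; ring.
Qed.

(** With [g = 1] this gives the first moment, and with [g] equal to the node
    it gives the second one. *)
Lemma sum_op_weight_node (g : nat -> R) :
  \sum_(k < n.+1) op_weight k * (node n w k * g k) =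
  x * \sum_(k < n) denom_weight k * g k.+1.
Proof.
rewrite -sum_gam_pred; apply: eq_bigr => k _.
by rewrite mulrA op_weight_node // -ltnS.
Qed.

Lemma sum_op_weight1 : \sum_(k < n.+1) op_weight k = 1.
Proof.
have := sum_op_weight (fun=> 1).
under eq_bigr do rewrite mulr1.
under [in X in _ = X -> _]eq_bigr do rewrite mulr1.
by rewrite sum_denom_weight => ->; ring.
Qed.

Lemma sum_op_weight_id : \sum_(k < n.+1) op_weight k * node n w k = x.
Proof.
have := sum_op_weight_node (fun=> 1).
under eq_bigr do rewrite mulr1.
under [in X in _ = X -> _]eq_bigr do rewrite mulr1.
by rewrite sum_denom_weight mulr1.
Qed.

(** The first moment has two expressions, [x] and [(1 - x) * A + x * B]; the
    second moment is [x * B].  Using the second expression for one factor of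
    [x ^ 2] leaves [x * (1 - x) * (B - A)]. *)
Lemma op_variance :
  \sum_(k < n.+1) op_weight k * (node n w k - x) ^+ 2 =
  x * (1 - x) * \sum_(k < n) denom_weight k * (node n w k.+1 - node n w k).
Proof.
pose A := \sum_(k < n) denom_weight k * node n w k.
pose B := \sum_(k < n) denom_weight k * node n w k.+1.
have xAB : x = (1 - x) * A + x * B by rewrite -sum_op_weight sum_op_weight_id.
transitivity (x * B - x ^+ 2).
  rewrite -(sum_op_weight_node (node n w)).
  transitivity (\sum_(k < n.+1) (op_weight k * (node n w k * node n w k)
    - 2 * x * (op_weight k * node n w k) + x ^+ 2 * op_weight k)).
    by apply: eq_bigr => k _; ring.
  rewrite big_split sumrB /= -!mulr_sumr sum_op_weight_id sum_op_weight1; ring.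
have -> : \sum_(k < n) denom_weight k * (node n w k.+1 - node n w k) = B - A.
  by rewrite -sumrB; apply: eq_bigr => k _; rewrite mulrBr.
rewrite expr2 {3}xAB; ring.
Qed.

Lemma op_variance_le_mesh :
  \sum_(k < n.+1) op_weight k * (node n w k - x) ^+ 2 <=
  x * (1 - x) * mesh n w.
Proof.
move: (x01); rewrite in_itv /= => /andP[x0 x1].
rewrite op_variance ler_wpM2l ?mulr_ge0 ?subr_ge0 //.
rewrite -[leRHS]mul1r -sum_denom_weight mulr_suml; apply: ler_sum => k _.
by rewrite ler_wpM2l ?denom_weight_ge0 ?node_step_le_mesh.
Qed.

Lemma rat_bernsteinE (f : R -> R) :
  rat_bernstein n Q w f x = \sum_(k < n.+1) op_weight k * f (node n w k).
Proof. by apply: eq_bigr => k _; rewrite /op_weight; ring. Qed.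

End RationalBernstein.

Theorem theorem9 (R : realType) (n : nat) (Q : {poly R}) (w : nat -> R)
    (hn : (1 <= n)%N)
    (hdeg : (size Q <= n)%N)
    (hpos : forall t : R, t \in `[0, 1] -> 0 < Q.[t])
    (hQw : is_bernstein_coefs n Q w)
    (hi : forall k : nat, (k < n)%N -> 0 < w k)
    (hW : propertyW n w)
    (f : R -> R) (hf : {within `[0, 1], continuous f})
    (x : R) (hx : x \in `[0, 1]) :
  `|rat_bernstein n Q w f x - f x| <=
    (1 + Num.sqrt (x * (1 - x))) * modulus1 f (Num.sqrt (mesh n w)).
Proof.
rewrite rat_bernsteinE.
have Qx := hpos _ hx.
have d0 : 0 < Num.sqrt (mesh n w) by rewrite sqrtr_gt0 mesh_gt0.
have wge0 (k : 'I_n.+1) : 0 <= op_weight n w Q x k.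
  by rewrite op_weight_ge0 // -ltnS.
have t01 (k : 'I_n.+1) : node n w k \in `[0, 1] by rewrite node_itv // -ltnS.
have bound := average_modulus1_bound wge0 (sum_op_weight1 hn hQw Qx)
  hf d0 t01 hx.
apply: (le_trans bound).
rewrite ler_wpM2r ?modulus1_ge0 ?(ltW d0) // lerD2l ler_pdivrMr //.
move: (hx); rewrite in_itv /= => /andP[x0 x1].
rewrite -sqrtrM ?mulr_ge0 ?subr_ge0 //; apply: ler_wsqrtr.
exact: op_variance_le_mesh.
Qed.
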